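(* Let $\omega$ be any one of the transformations $p_i,\ p'_i$ ($i\in\mathbb{Z}_{n+1}$), $\sigma,\ \sigma',\ \pi_1,\ \pi_2$ of $\widetilde{G}$ defined in the context. Let $\varepsilon$ denote the specialization $\varphi_{2k+1,1}\mapsto -1$ ($k=0,\ldots,n$), all other $\varphi_{j,i}$ being left unchanged. Under $\varepsilon$ one has $\varphi_{2k+1,0}=-\alpha_{2k+1}$ and $\varphi_{2k+1,1}=-1$ for $k=0,\ldots,n$; call this ''condition (C)''. Then, for every $j=0,\ldots,n$, the specialization $\varepsilon(\omega(\varphi_{2j+1,1}))$ is well defined and satisfies \[ \varepsilon\bigl(\omega(\varphi_{2j+1,1})\bigr)=-1,\qquad \varepsilon\bigl(\omega(\varphi_{2j+1,0})\bigr)=-\varepsilon\bigl(\omega(\alpha_{2j+1})\bigr). \] In other words, the action of $\omega$ on the dependent variables is consistent with condition (C).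
   Context: Fix an integer $n\ge1$. Let $\varphi_{j,i}$ ($j\in\mathbb{Z}_{2n+2}$, $i\in\mathbb{Z}_2$) be independent indeterminates, and let $K=\mathbb{C}(\varphi_{j,i})$. First indices are taken modulo $2n+2$ and second indices modulo $2$. Put $\alpha_j=\varphi_{j,0}\varphi_{j,1}$, $\beta_i=\prod_{j=0}^{2n+1}\varphi_{j,i}$, $\beta'_i=\prod_{j=0}^{2n+1}\varphi_{j,i+j}$, $q=\prod_{j=0}^{2n+1}\alpha_j$, and $\varphi'_{j,i}=\varphi_{-j,i-j}$. Define $Q_{j,i}=\sum_{k=0}^{2n+1}\prod_{l=0}^{k-1}\varphi_{j+l,i}$ and $Q'_{j,i}=\sum_{k=0}^{2n+1}\prod_{l=0}^{k-1}\varphi'_{j+l,i}$. The following field automorphisms of $K$ are given by their values on the generators and are extended as field homomorphisms. - $r_j$ ($j\in\mathbb{Z}_{2n+2}$): $r_j(\varphi_{j-1,i})=\varphi_{j-1,i}\varphi_{j,i+1}\frac{1+\varphi_{j,i}}{1+\varphi_{j,i+1}}$, $r_j(\varphi_{j,i})=\frac{1}{\varphi_{j,i+1}}$, $r_j(\varphi_{j+1,i})=\varphi_{j,i}\varphi_{j+1,i}\frac{1+\varphi_{j,i+1}}{1+\varphi_{j,i}}$, and $r_j(\varphi_{k,i})=\varphi_{k,i}$ for $k\ne j,j\pm1$. - $s_i$ ($i\in\mathbb{Z}_2$): $s_i(\varphi_{j,i})=\frac{1}{\varphi_{j+1,i}}\frac{Q_{j,i}}{Q_{j+2,i}}$ and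 $s_i(\varphi_{j,i+1})=\varphi_{j,i}\varphi_{j,i+1}\varphi_{j+1,i}\frac{Q_{j+2,i}}{Q_{j,i}}$ for all $j$. - $s'_i$ ($i\in\mathbb{Z}_2$): $s'_i(\varphi'_{j,i})=\frac{1}{\varphi'_{j+1,i}}\frac{Q'_{j,i}}{Q'_{j+2,i}}$ and $s'_i(\varphi'_{j,i+1})=\varphi'_{j,i}\varphi'_{j,i+1}\varphi'_{j+1,i}\frac{Q'_{j+2,i}}{Q'_{j,i}}$ for all $j$. - $\pi(\varphi_{j,i})=\varphi_{j+1,i+1}$, $\pi'(\varphi_{j,i})=\varphi_{j+1,i}$, $\rho(\varphi_{j,i})=\varphi'_{j,i}$. Composition is composition of automorphisms: $(\omega_1\omega_2)(f)=\omega_1(\omega_2(f))$. For example, $r_0r_1(\alpha_0)=r_0(\alpha_0\alpha_1)=r_0(\alpha_0)r_0(\alpha_1)=\alpha_1$. Let $\widetilde{G}$ be the group generated by all $r_j,s_i,s'_i,\pi,\pi',\rho$. Define, for $i\in\mathbb{Z}_{n+1}$ (indices of $r$ taken modulo $2n+2$): - $p_i=r_{-2i-3}r_{-2i-2}r_{-2i-3}$ and $p'_i=r_{-2i-4}r_{-2i-3}r_{-2i-4}$; - $\sigma=\pi\,s_0\,r_1r_3\cdots r_{2n+1}$ and $\sigma'=(\pi')^{-1}s'_0\,r_0r_2\cdots r_{2n}$; - $\pi_1=\pi^2$ and $\pi_2=\rho(\pi')^{-1}\pi$. *)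

(* Defs.v *)
From HB Require Import structures.
From mathcomp Require Import all_boot all_order all_algebra.
From mathcomp Require Import reals.
From mathcomp.real_closed Require Import complex.
From mathcomp Require Import mpoly.

Set Implicit Arguments.
Unset Strict Implicit.
Unset Printing Implicit Defensive.

Import Order.TTheory GRing.Theory Num.Theory.
Local Open Scope ring_scope.

(* Variables phi_{j,i}, j in Z_{2n+2}, i in Z_2, are encoded as the
   mpoly variables 'X_k, k = 2 * (j mod (2n+2)) + (i mod 2) < 4n+4.      *)
Definition Nv (n : nat) : nat := (4 * n + 3).+1.
Definition Mn (n : nat) : int := (2 * n + 2)%N%:Z.

Definition eqm (n : nat) (a b : int) : bool := modz (a - b) (Mn n) == 0.

Definition idx (n : nat) (j i : int) : 'I_(Nv n) :=
  inord (absz (modz j (Mn n)) * 2 + absz (modz i 2)).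

Section Field.
Variables (R : realType) (n : nat).

Definition Cf : fieldType := R[i].
Definition Pr := {mpoly Cf[Nv n]}.
Definition K : fieldType := {fraction Pr}.

Definition phi (j i : int) : K := tofrac ('X_(idx n j i) : Pr).
Definition alpha (j : int) : K := phi j 0 * phi j 1.
Definition phi' (j i : int) : K := phi (- j) (i - j).

Definition Q (j i : int) : K :=
  \sum_(k < 2 * n + 2) \prod_(l < k) phi (j + (l : nat)%:Z) i.
Definition Q' (j i : int) : K :=
  \sum_(k < 2 * n + 2) \prod_(l < k) phi' (j + (l : nat)%:Z) i.

Definition fixes_const (w : K -> K) : Prop :=
  forall c : Cf, w (tofrac (c%:MP : Pr)) = tofrac (c%:MP : Pr).

Definition is_r (j : int) (w : K -> K) : Prop :=
  fixes_const w /\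
  forall i : int,
  [/\ w (phi (j - 1) i) =
        phi (j - 1) i * phi j (i + 1) * ((1 + phi j i) / (1 + phi j (i + 1))),
      w (phi j i) = (phi j (i + 1))^-1,
      w (phi (j + 1) i) =
        phi j i * phi (j + 1) i * ((1 + phi j (i + 1)) / (1 + phi j i))
    & forall k : int, ~~ eqm n k j -> ~~ eqm n k (j - 1) -> ~~ eqm n k (j + 1) ->
        w (phi k i) = phi k i].

Definition is_s (i : int) (w : K -> K) : Prop :=
  fixes_const w /\
  forall j : int,
    w (phi j i) = (phi (j + 1) i)^-1 * (Q j i / Q (j + 2) i) /\
    w (phi j (i + 1)) = phi j i * phi j (i + 1) * phi (j + 1) i * (Q (j + 2) i / Q j i).

Definition is_s' (i : int) (w : K -> K) : Prop :=
  fixes_const w /\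
  forall j : int,
    w (phi' j i) = (phi' (j + 1) i)^-1 * (Q' j i / Q' (j + 2) i) /\
    w (phi' j (i + 1)) =
      phi' j i * phi' j (i + 1) * phi' (j + 1) i * (Q' (j + 2) i / Q' j i).

Definition is_pi (w : K -> K) : Prop :=
  fixes_const w /\ forall j i : int, w (phi j i) = phi (j + 1) (i + 1).
Definition is_pi' (w : K -> K) : Prop :=
  fixes_const w /\ forall j i : int, w (phi j i) = phi (j + 1) i.
Definition is_rho (w : K -> K) : Prop :=
  fixes_const w /\ forall j i : int, w (phi j i) = phi' j i.

Definition p_ (r : int -> K -> K) (i : int) : K -> K :=
  r (- 2 * i - 3) \o r (- 2 * i - 2) \o r (- 2 * i - 3).
Definition p'_ (r : int -> K -> K) (i : int) : K -> K :=
  r (- 2 * i - 4) \o r (- 2 * i - 3) \o r (- 2 * i - 4).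
Definition r_odd (r : int -> K -> K) : K -> K :=
  foldr (fun k f => r (2 * (k : nat)%:Z + 1) \o f) id (iota 0 n.+1).
Definition r_even (r : int -> K -> K) : K -> K :=
  foldr (fun k f => r (2 * (k : nat)%:Z) \o f) id (iota 0 n.+1).
Definition sigma_ (pi : K -> K) (s : int -> K -> K) (r : int -> K -> K) : K -> K :=
  pi \o s 0 \o r_odd r.
Definition sigma'_ (pi'inv : K -> K) (s' : int -> K -> K) (r : int -> K -> K)
  : K -> K := pi'inv \o s' 0 \o r_even r.
Definition pi1_ (pi : K -> K) : K -> K := pi \o pi.
Definition pi2_ (rho pi'inv pi : K -> K) : K -> K := rho \o pi'inv \o pi.

Definition is_omega (r s s' : int -> K -> K) (pi pi'inv rho : K -> K)
  (w : K -> K) : Prop :=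
  (exists i : 'I_n.+1, w = p_ r (i : nat)%:Z) \/
  (exists i : 'I_n.+1, w = p'_ r (i : nat)%:Z) \/
  w = sigma_ pi s r \/ w = sigma'_ pi'inv s' r \/
  w = pi1_ pi \/ w = pi2_ rho pi'inv pi.

Definition eps_var (k : 'I_(Nv n)) : Pr :=
  if [exists kk : 'I_n.+1, k == idx n (2 * (kk : nat)%:Z + 1) 1] then -1
  else 'X_k.
Definition eps_poly (p : Pr) : Pr := mmap (fun c : Cf => c%:MP) eps_var p.

(* "eps(f) is well defined and equals g": f can be written p/q with
   eps(q) <> 0, and then eps(f) := eps(p)/eps(q) = g. *)
Definition spec_to (f g : K) : Prop :=
  exists p q : Pr, [/\ eps_poly q != 0, f = tofrac p / tofrac q &
                       g = tofrac (eps_poly p) / tofrac (eps_poly q)].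

End Field.

(* Main.v *)
(** A letter of the group acts by explicit rational functions, so each claim is an identity
    between regular values at condition (C); the values are computed with a relation [S f g],
    "f is regular and specializes to g", which respects the field operations.
    - For [r_a r_(a+1) r_a] the images of the four neighbouring variables are, after
      cancelling the poles created by [1 + phi_(a,1) = 0], all expressed by one function
      [braid], whose numerator and denominator specialize to opposite elements.
    - For sigma the image of [phi_(j,1)] is [phi_(j+2,1) Q_(j+3,1) / Q_(j+1,1)]; with every odd
      factor equal to -1 the sum [Q_(j,1)], [j] even, telescopes to a value independent
      of [j].
    - For sigma' the sums only involve unspecialized variables, and the recursion
      [Q'_j = phi'_j Q'_(j+1) + (1 - prod phi')] factors every [1 + image], after which
      everything cancels.
    Apart from the variables themselves, the elements to be shown nonzero take the value 1
    when all variables vanish. *)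
Require Import Defs.
From HB Require Import structures.
From mathcomp Require Import all_boot all_order all_algebra.
From mathcomp Require Import reals.
From mathcomp.real_closed Require Import complex.
From mathcomp Require Import mpoly.
From mathcomp Require Import zify ring.
Set Implicit Arguments.
Unset Strict Implicit.
Unset Printing Implicit Defensive.
Import Order.TTheory GRing.Theory Num.Theory.
Local Open Scope ring_scope.

(** * Regular elements of a fraction field and their values *)

Section Specialization.
Variables (D : idomainType) (L : fieldType) (e : {rmorphism D -> L}).

(** A relation, because specialization is only partially defined on fractions. The morphism [e] is
    left arbitrary: it will be either [eps] or evaluation at the origin. *)
Definition gspec (f : {fraction D}) (g : L) : Prop :=
  exists p q : D, [/\ e q != 0, f = tofrac p / tofrac q & g = e p / e q].

Lemma gspec_poly p : gspec (tofrac p) (e p).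
Proof. by exists p, 1; rewrite !rmorph1 oner_eq0 !divr1. Qed.

Lemma gspec1 : gspec 1 1.
Proof. by have := gspec_poly 1; rewrite !rmorph1. Qed.

Lemma gspecN f g : gspec f g -> gspec (- f) (- g).
Proof. by move=> [p [q [q0 -> ->]]]; exists (- p), q; rewrite !rmorphN !mulNr. Qed.

Lemma tofrac_neq0 q : e q != 0 -> tofrac q != 0.
Proof. by apply: contraNneq => /eqP; rewrite tofrac_eq0 => /eqP->; rewrite rmorph0. Qed.

Lemma gspecD f1 g1 f2 g2 :
  gspec f1 g1 -> gspec f2 g2 -> gspec (f1 + f2) (g1 + g2).
Proof.
move=> [p1 [q1 [n1 -> ->]]] [p2 [q2 [n2 -> ->]]].
exists (p1 * q2 + p2 * q1), (q1 * q2).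
by rewrite !rmorphM !rmorphD !rmorphM /= mulf_neq0 // !addf_div ?tofrac_neq0.
Qed.

Lemma gspecM f1 g1 f2 g2 :
  gspec f1 g1 -> gspec f2 g2 -> gspec (f1 * f2) (g1 * g2).
Proof.
move=> [p1 [q1 [n1 -> ->]]] [p2 [q2 [n2 -> ->]]].
by exists (p1 * p2), (q1 * q2); rewrite !rmorphM /= mulf_neq0 // !mulf_div.
Qed.

Lemma gspecV f g : g != 0 -> gspec f g -> gspec f^-1 g^-1.
Proof.
move=> + [p [q [n ef eg]]]; rewrite {}ef {}eg => g0.
exists q, p; split; rewrite ?invf_div //.
by apply: contraNneq g0 => ->; rewrite mul0r.
Qed.

(** This is how nonvanishing is certified later: one evaluation with a nonzero value suffices. *)
Lemma gspec_neq0 f g : gspec f g -> g != 0 -> f != 0.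
Proof.
move=> [p [q [n -> ->]]]; rewrite !mulf_eq0 !invr_eq0 !negb_or => /andP[p0 _].
by rewrite !tofrac_neq0.
Qed.

End Specialization.

(** * Sums of products of consecutive terms of a sequence *)

Section CyclicSums.
Variables (F : fieldType).
Implicit Type g : int -> F.

(** For [g] a row of variables and [N = 2n+2], [csum g N] is the function $Q$ or $Q'$ of that
    row. *)
Definition cprod g (m : nat) (j : int) := \prod_(l < m) g (j + (l : nat)%:Z).
Definition csum g (N : nat) (j : int) := \sum_(k < N) cprod g k j.

Lemma cprodS g m j : cprod g m.+1 j = g j * cprod g m (j + 1).
Proof.
rewrite /cprod big_ord_recl addr0; congr (_ * _).
by apply: eq_bigr => l _; congr g; rewrite lift0; lia.
Qed.

Lemma cprodSr g m j : cprod g m.+1 j = cprod g m j * g (j + m%:Z).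
Proof. by rewrite /cprod big_ord_recr. Qed.

(** Multiplying the sum from [j + 1] by [g j] yields the products from [j] of lengths 1 to N instead
    of 0 to N-1; the two end terms make up the difference. *)
Lemma csumS g N j : csum g N j = g j * csum g N (j + 1) + (1 - cprod g N j).
Proof.
elim: N => [|N IH]; first by rewrite /csum /cprod !big_ord0 mulr0 subrr addr0.
have cS h : csum g N.+1 h = csum g N h + cprod g N h by rewrite /csum big_ord_recr.
by rewrite !cS {}IH cprodS; ring.
Qed.

(** Multiplied by [g j], both sides become the product of N+1 consecutive factors, whose last factor
    is [g j] again by periodicity. *)
Lemma cprod_shift g N j :
  (forall k, g (k + N%:Z) = g k) -> g j != 0 -> cprod g N (j + 1) = cprod g N j.
Proof. by move=> gN g0; apply: (mulfI g0); rewrite -cprodS cprodSr gN mulrC. Qed.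

(* The terms of the sum cancel in pairs 2m+1, 2m+2. *)
Lemma csum_alternating g m j :
  (forall l : nat, g (j + (2 * l + 1)%N%:Z) = -1) ->
  csum g (2 * m + 2) j = 1 + cprod g (2 * m + 1) j.
Proof.
move=> godd; have cS N : csum g N.+1 j = csum g N j + cprod g N j.
  by rewrite /csum big_ord_recr.
elim: m => [|m IH].
  by rewrite !cS /csum big_ord0 add0r {1}/cprod big_ord0.
have -> : (2 * m.+1 + 2 = (2 * m + 2).+2)%N by lia.
have -> : (2 * m.+1 + 1 = (2 * m + 2).+1)%N by lia.
rewrite !cS IH -addrA -[RHS]addr0 -!addrA; congr (_ + _).
rewrite addrA addrC; congr (_ + _).
have -> : (2 * m + 2 = (2 * m + 1).+1)%N by lia.
by rewrite (cprodSr _ (2 * m + 1)) godd mulrN1 subrr.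
Qed.

(** The product of the 2m+3 factors from [j] is computed twice: splitting off the first two factors,
    or the last two, leaves in both cases [- g j] times a product of length 2m+1, started at [j + 2]
    or at [j]. *)
Lemma csum_alternating_shift g m j :
  (forall l : nat, g (j + (2 * l + 1)%N%:Z) = -1) ->
  (forall k, g (k + (2 * m + 2)%N%:Z) = g k) -> g j != 0 ->
  csum g (2 * m + 2) (j + 2) = csum g (2 * m + 2) j.
Proof.
move=> godd gper g0.
have godd' (l : nat) : g (j + 2 + (2 * l + 1)%N%:Z) = -1.
  by rewrite -(godd l.+1); congr g; lia.
rewrite !csum_alternating //; congr (_ + _); apply: (mulfI g0).
have e1 : cprod g (2 * m + 3) j = g j * g (j + 1) * cprod g (2 * m + 1) (j + 2).
  by rewrite (_ : (2 * m + 3 = (2 * m + 1).+2)%N) ?cprodS; [rewrite mulrA -addrA | lia].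
have e2 : cprod g (2 * m + 3) j = - (g j * cprod g (2 * m + 1) j).
  rewrite (_ : (2 * m + 3 = (2 * m + 1).+2)%N); last by lia.
  rewrite !cprodSr godd (_ : (2 * m + 1).+1 = (2 * m + 2)%N) ?gper; last by lia.
  ring.
have h1 : g (j + 1) = -1 by rewrite -(godd 0%N).
by apply: oppr_inj; rewrite -e2 e1 h1; ring.
Qed.

Lemma rmorph_csum (f : {rmorphism F -> F}) g h N j d :
  (forall k, f (g k) = h (k + d)) -> f (csum g N j) = csum h N (j + d).
Proof.
move=> fg; rewrite rmorph_sum; apply: eq_bigr => k _; rewrite rmorph_prod.
by apply: eq_bigr => l _; rewrite fg addrAC.
Qed.

Lemma cprod0 m j : cprod (fun=> 0) m.+1 j = 0.
Proof. by rewrite cprodS mul0r. Qed.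

Lemma csum0 N j : csum (fun=> 0) N.+1 j = 1.
Proof. by rewrite csumS cprod0 mul0r subr0 add0r. Qed.

End CyclicSums.

(** * Field morphisms applied to the shapes occurring in the generators *)

Section RationalMorphisms.
Variables (F : fieldType).

Lemma rmorph_ratio (p : {rmorphism F -> F}) y q q' :
  p (y^-1 * (q / q')) = (p y)^-1 * (p q / p q').
Proof. by rewrite !(rmorphM, fmorphV). Qed.

Lemma rmorph_ratio2 (p : {rmorphism F -> F}) x y z q q' :
  p (x * y * z * (q / q')) = p x * p y * p z * (p q / p q').
Proof. by rewrite !(rmorphM, fmorphV). Qed.

(** The expression is the factor by which a letter $r_k$ multiplies a neighbouring variable. *)
Lemma rmorph_fix (p : {rmorphism F -> F}) a a' :
  p a = a -> p a' = a' ->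
  p (a * ((1 + a') / (1 + a))) = a * ((1 + a') / (1 + a)).
Proof. by move=> pa pa'; rewrite !(rmorphM, fmorphV, rmorphD, rmorph1) pa pa'. Qed.

Lemma rmorph_shift (p : {rmorphism F -> F}) x a a' b b' :
  p (x * (a * ((1 + a') / (1 + a))) * (b * ((1 + b') / (1 + b)))) =
  p x * (p a * ((1 + p a') / (1 + p a))) * (p b * ((1 + p b') / (1 + p b))).
Proof. by rewrite !(rmorphM, fmorphV, rmorphD, rmorph1). Qed.

End RationalMorphisms.

(** * Products of letters of equal parity acting on one variable *)

Section Folds.
Variables (F : fieldType) (f : nat -> {rmorphism F -> F}).
Local Notation fold s := (foldr (fun k (g : F -> F) => f k \o g) id s).

Lemma fold_one s a x y :
  uniq s -> f a x = y -> (forall k, k \in s -> k != a -> f k x = x) ->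
  (forall k, k \in s -> k != a -> f k y = y) ->
  fold s x = if a \in s then y else x.
Proof.
move=> us fax fx fy; elim: s us fx fy => //= k s IH /andP[ks us] fx fy.
rewrite {}IH //; last first.
- by move=> l ls; apply: fy; rewrite inE ls orbT.
- by move=> l ls; apply: fx; rewrite inE ls orbT.
rewrite inE; have [ak|ak] := eqVneq a k; last first.
  by case: ifP => _; [apply: fy | apply: fx]; rewrite ?mem_head // eq_sym.
by rewrite ak (negbTE ks) -ak.
Qed.

(** Here [x] has two neighbouring letters. The cofactor created by one is fixed by the other, so the
    two contributions multiply without interacting. *)
Lemma fold_two s a b x u v :
  uniq s -> a != b -> f a x = x * u -> f b x = x * v ->
  (forall k, k \in s -> k != a -> k != b -> f k x = x) ->
  (forall k, k \in s -> k != a -> f k u = u) ->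
  (forall k, k \in s -> k != b -> f k v = v) ->
  fold s x = x * (if a \in s then u else 1) * (if b \in s then v else 1).
Proof.
move=> us ab fax fbx fx fu fv; elim: s us fx fu fv => [|k s IH] /=.
  by rewrite !mulr1.
move=> /andP[ks us] fx fu fv; rewrite {}IH //; last first.
- by move=> l ls; apply: fv; rewrite inE ls orbT.
- by move=> l ls; apply: fu; rewrite inE ls orbT.
- by move=> l ls; apply: fx; rewrite inE ls orbT.
have fu' : k != a -> f k (if a \in s then u else 1) = if a \in s then u else 1.
  by move=> ka; case: ifP => _; rewrite ?rmorph1 // fu ?mem_head.
have fv' : k != b -> f k (if b \in s then v else 1) = if b \in s then v else 1.
  by move=> kb; case: ifP => _; rewrite ?rmorph1 // fv ?mem_head.
rewrite !rmorphM !inE; have [ak|ak] := eqVneq a k.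
  rewrite -!ak in ks fv' *; rewrite (negbTE ks) rmorph1 mulr1 fax fv' //.
  by rewrite eq_sym (negbTE ab).
rewrite fu' 1?eq_sym //; have [bk|bk] := eqVneq b k.
  by rewrite -!bk in ks *; rewrite (negbTE ks) rmorph1 mulr1 fbx mulrAC.
by rewrite fv' 1?eq_sym // fx ?mem_head // eq_sym.
Qed.

Lemma fold_morphM s : {morph fold s : x y / x * y}.
Proof.
elim: s => [//|k s IH] x y.
exact: etrans (congr1 (f k) (IH x y)) (rmorphM (f k) _ _).
Qed.

End Folds.

(* [S f g] reads "f is regular with value g". *)
Record place (F L : fieldType) (S : F -> L -> Prop) : Prop := Place {
  place1 : S 1 1;
  placeD : forall f f' g g', S f f' -> S g g' -> S (f + g) (f' + g');
  placeN : forall f f', S f f' -> S (- f) (- f');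
  placeM : forall f f' g g', S f f' -> S g g' -> S (f * g) (f' * g');
  placeV : forall f f', f' != 0 -> S f f' -> S f^-1 f'^-1 }.

(** * Values of cyclic products and sums *)

Section CyclicSumPlaces.
Variables (F L : fieldType) (S : F -> L -> Prop).
Hypothesis SP : place S.

Lemma place0 : S 0 0.
Proof.
by rewrite -(subrr 1) -[X in S _ X](subrr 1); apply: (placeD SP); last apply: (placeN SP);
  exact: (place1 SP).
Qed.

Lemma place_cprod g g' m j :
  (forall k, S (g k) (g' k)) -> S (cprod g m j) (cprod g' m j).
Proof.
move=> gg'; elim: m => [|m IH]; first by rewrite /cprod !big_ord0; apply: (place1 SP).
by rewrite !cprodSr; apply: (placeM SP).
Qed.

Lemma place_csum g g' N j :
  (forall k, S (g k) (g' k)) -> S (csum g N j) (csum g' N j).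
Proof.
move=> gg'; elim: N => [|N IH]; first by rewrite /csum !big_ord0; apply: place0.
by rewrite /csum !big_ord_recr; apply: (placeD SP) => //; apply: place_cprod.
Qed.

End CyclicSumPlaces.

(** * Values of the rational expressions produced by the words *)

Section Places.
Variables (F : fieldType) (S : F -> F -> Prop).
Hypothesis SP : place S.
Let D := placeD SP.
Let M := placeM SP.
Let V := placeV SP.
Let s1 := place1 SP.

(* [x, x', y, y'] stand for [phi_(a,i), phi_(a,i+1), phi_(a+1,i), phi_(a+1,i+1)]. *)
Definition braid (x x' y y' : F) : F :=
  (x * y * (1 + x') + (1 + x)) / (y * (1 + x' + x' * y' * (1 + x))).

(** At [x = -1] numerator and denominator reduce to [- y * (1 + x')] and [y * (1 + x')]. The value
    of the other [braid] must be nonzero because it occurs as a denominator in the image of an outer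
    neighbour. *)
Lemma place_braid x x' y y' :
  y != 0 -> y' != 0 -> 1 + x' != 0 ->
  S x (-1) -> S x' x' -> S y y -> S y' y' ->
  S (braid x x' y y') (-1) /\
  exists2 h, h != 0 & S (braid x' x y' y) h.
Proof.
move=> y0 y'0 x'1 sx sx' sy sy'; have m0 : -1 != 0 :> F by rewrite oppr_eq0 oner_eq0.
split.
- have -> : -1 = (-1 * y * (1 + x') + (1 + -1)) / (y * (1 + x' + x' * y' * (1 + -1))).
    by rewrite subrr mulr0 !addr0 mulN1r !mulNr divff // mulf_neq0.
  apply: (M); last apply: V.
  + by repeat first [apply: (D) | apply: (M)].
  + by rewrite subrr mulr0 addr0 mulf_neq0.
  + by repeat first [apply: (D) | apply: (M)].
- exists ((x' * y' * (1 + -1) + (1 + x')) / (y' * (1 + -1 + -1 * y * (1 + x')))).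
    by rewrite subrr mulr0 !add0r mulf_neq0 // invr_eq0 !mulf_neq0.
  apply: (M); last apply: V.
  + by repeat first [apply: (D) | apply: (M)].
  + by rewrite subrr add0r !mulf_neq0.
  + by repeat first [apply: (D) | apply: (M)].
Qed.

Lemma place_mul_div u u' v v' b h :
  h != 0 -> S u u' -> S v v' -> S b h -> S (u * v / b) (u' * v' / h).
Proof. by move=> h0 su sv sb; apply: (M); [apply: (M) | apply: V]. Qed.

Lemma place_mul_divN1 u v b :
  S u (-1) -> S v (-1) -> S b (-1) -> S (u * v / b) (-1).
Proof.
move=> su sv sb; have -> : -1 = -1 * -1 / -1 :> F.
  by rewrite mulrN1 opprK mul1r invrN invr1.
by apply: place_mul_div; rewrite // oppr_eq0 oner_eq0.
Qed.

(** Both sums have the same nonzero value [v], so their quotient contributes 1. *)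
Lemma place_ratio y q q' v :
  v != 0 -> S y (-1) -> S q v -> S q' v -> S (y^-1 * (q / q'))^-1 (-1).
Proof.
move=> v0 sy sq sq'; have -> : -1 = ((-1)^-1 * (v / v))^-1 :> F.
  by rewrite divff // mulr1 invrK.
have m0 : -1 != 0 :> F by rewrite oppr_eq0 oner_eq0.
apply: V; first by rewrite divff // mulr1 invr_eq0.
by apply: (M); [apply: V | apply: (M) => //; apply: V].
Qed.

Lemma place_ratio2 x x' y q q' v :
  v != 0 -> x != 0 -> x' != 0 -> S x x -> S x' x' -> S y (-1) -> S q v -> S q' v ->
  exists h, S (x * x' * y * (q' / q))^-1 h.
Proof.
move=> v0 x0 x'0 sx sx' sy sq sq'; exists (x * x' * -1 * (v / v))^-1; apply: V.
  by rewrite divff // mulr1 !mulf_neq0 // oppr_eq0 oner_eq0.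
by apply: (M); [do 2?apply: (M) | apply: (M) => //; apply: V].
Qed.

(* With [g_k, f_k, Q_k] for [phi'_(J+k,1), phi'_(J+k,0), Q'_(J+k,1)], [J] odd, the elements
   [Am, A0, Ap] and [Bm, B0, Bp] are the images of [phi'_(J-1,i), phi'_(J,i), phi'_(J+1,i)]
   under [(pi')^-1 s'_0] for [i = 0] and [i = 1]. *)
Lemma place_shifts (g0 g1 g2 g3 Q0 Q1 Q2 Q3 Q4 b : F) (fm fe fp : F) :
  Q0 = g0 * Q1 + b -> Q1 = g1 * Q2 + b -> Q2 = g2 * Q3 + b -> Q3 = g3 * Q4 + b ->
  g0 != 0 -> g1 != 0 -> g2 != 0 -> g3 != 0 ->
  Q0 != 0 -> Q1 != 0 -> Q2 != 0 -> Q3 != 0 -> Q4 != 0 -> b != 0 ->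
  1 + g0 != 0 -> 1 + g2 != 0 ->
  S g0 g0 -> S g1 g1 -> S g2 g2 -> S g3 g3 ->
  S Q0 Q0 -> S Q1 Q1 -> S Q2 Q2 -> S Q3 Q3 -> S Q4 Q4 ->
  S fm (-1) -> S fe fe -> S fp (-1) ->
  let A g Q Q' := g^-1 * (Q / Q') in
  let B g f g' Q Q' := g * f * g' * (Q' / Q) in
  let Am := A g1 Q0 Q2 in let A0 := A g2 Q1 Q3 in let Ap := A g3 Q2 Q4 in
  let Bm := B g0 fm g1 Q0 Q2 in let B0 := B g1 fe g2 Q1 Q3 in
  let Bp := B g2 fp g3 Q2 Q4 in
  S (A0 * (Bp * ((1 + Ap) / (1 + Bp))) * (Am * ((1 + Bm) / (1 + Am)))) (-1) /\
  exists h, S (B0 * (Ap * ((1 + Bp) / (1 + Ap))) * (Bm * ((1 + Am) / (1 + Bm)))) h.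
Proof.
move=> e0 e1 e2 e3 g0n g1n g2n g3n Q0n Q1n Q2n Q3n Q4n bn g0a g2a.
move=> sg0 sg1 sg2 sg3 sQ0 sQ1 sQ2 sQ3 sQ4 sfm sfe sfp A B.
have sA g Q Q' : g != 0 -> Q' != 0 -> S g g -> S Q Q -> S Q' Q' -> S (A g Q Q') (A g Q Q').
  by move=> gn Qn sg sQ sQ'; apply: (M); [apply: V|apply: (M) => //; apply: V].
have sB g f f' g' Q Q' : Q != 0 -> S g g -> S f f' -> S g' g' -> S Q Q -> S Q' Q' ->
    S (B g f g' Q Q') (B g f' g' Q Q').
  by move=> Qn sg sf sg' sQ sQ'; do 3?[apply: (M) => //]; apply: V.
have bE : b = Q1 - g1 * Q2 by rewrite e1 addrC addKr.
(* The recursion gives [Q0 + g1 * Q2 = (g0 * Q1 + b) + (Q1 - b)], where [b] cancels. *)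
have Am1 : 1 + A g1 Q0 Q2 = (1 + g0) * Q1 / (g1 * Q2).
  by rewrite /A e0 bE; field; rewrite g1n Q2n.
have Ap1 : 1 + A g3 Q2 Q4 = (1 + g2) * Q3 / (g3 * Q4).
  rewrite /A e2 (_ : b = Q3 - g3 * Q4); last by rewrite e3 addrC addKr.
  by field; rewrite g3n Q4n.
(* The value -1 of [fm] is what makes this factor: it shares [1 + g0] with [Am1], and [Bp1] shares
   [1 + g2] with [Ap1]. *)
have Bm1 : 1 + B g0 (-1) g1 Q0 Q2 = b * (1 + g0) / Q0.
  have -> : b * (1 + g0) = Q0 - g0 * g1 * Q2 by rewrite e0 e1; ring.
  by rewrite /B; field.
have Bp1 : 1 + B g2 (-1) g3 Q2 Q4 = b * (1 + g2) / Q2.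
  have -> : b * (1 + g2) = Q2 - g2 * g3 * Q4 by rewrite e2 e3; ring.
  by rewrite /B; field.
have Am1n : 1 + A g1 Q0 Q2 != 0 by rewrite Am1 !mulf_neq0 // invr_eq0 mulf_neq0.
have Ap1n : 1 + A g3 Q2 Q4 != 0 by rewrite Ap1 !mulf_neq0 // invr_eq0 mulf_neq0.
have Bm1n : 1 + B g0 (-1) g1 Q0 Q2 != 0 by rewrite Bm1 !mulf_neq0 // invr_eq0.
have Bp1n : 1 + B g2 (-1) g3 Q2 Q4 != 0 by rewrite Bp1 !mulf_neq0 // invr_eq0.
move=> Am A0 Ap Bm B0 Bp.
have sAm : S Am Am by apply: sA.
have sA0 : S A0 A0 by apply: sA.
have sAp : S Ap Ap by apply: sA.
have sBm : S Bm (B g0 (-1) g1 Q0 Q2) by apply: sB.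
have sB0 : S B0 B0 by apply: sB.
have sBp : S Bp (B g2 (-1) g3 Q2 Q4) by apply: sB.
split.
- suff -> : -1 = A0 * (B g2 (-1) g3 Q2 Q4 * ((1 + Ap) / (1 + B g2 (-1) g3 Q2 Q4)))
      * (Am * ((1 + B g0 (-1) g1 Q0 Q2) / (1 + Am))).
    by repeat first [apply: (D) | apply: (M) | apply: V] => //.
  rewrite Am1 Ap1 Bm1 Bp1 /A0 /Am /A /B; field.
  by rewrite Q2n g1n Q1n g0a Q0n g2a bn Q4n g3n Q3n g2n.
- exists (B0 * (Ap * ((1 + B g2 (-1) g3 Q2 Q4) / (1 + Ap)))
      * (B g0 (-1) g1 Q0 Q2 * ((1 + Am) / (1 + B g0 (-1) g1 Q0 Q2)))).
  by repeat first [apply: (D) | apply: (M) | apply: V] => //.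
Qed.

(** * The word $r_a r_{a+1} r_a$ in closed form *)

Variables (x0 x1 y0 y1 : F).
Hypotheses (x0n : x0 != 0) (x1n : x1 != 0) (y0n : y0 != 0) (y1n : y1 != 0).
Hypotheses (x0a : 1 + x0 != 0) (x1a : 1 + x1 != 0).
(** [Y0] and [Y1] are the images of [y0] and [y1] under the outer letter [ra]. The four sums assumed
    nonzero below are the nontrivial factors in the numerators of [1 + Y1], [1 + Z0], [1 + Z1] and
    [1 + Y0]. *)
Let Y0 := x0 * y0 * ((1 + x1) / (1 + x0)).
Let Y1 := x1 * y1 * ((1 + x0) / (1 + x1)).
Hypothesis n1 : 1 + x1 + x1 * y1 * (1 + x0) != 0.
Hypotheses (E0n : 1 + y1 + y1 * x0 * (1 + y0) != 0) (E1n : 1 + y0 + y0 * x1 * (1 + y1) != 0).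
Hypothesis n0 : 1 + x0 + x0 * y0 * (1 + x1) != 0.

Let Y0a : 1 + Y0 = (1 + x0 + x0 * y0 * (1 + x1)) / (1 + x0).
Proof. by rewrite /Y0; field. Qed.
Let Y1a : 1 + Y1 = (1 + x1 + x1 * y1 * (1 + x0)) / (1 + x1).
Proof. by rewrite /Y1; field. Qed.

Lemma braid_first :
  (x0^-1 * Y0 * ((1 + Y1) / (1 + Y0)))^-1 = braid x0 x1 y0 y1.
Proof.
rewrite !invfM !invrK Y0a Y1a /Y0 /braid; field.
by rewrite x0n y0n x0a x1a n1.
Qed.

(** The left side is [x0 * z] times the expression inverted in [braid_first]. *)
Lemma braid_right z :
  Y0 * z * ((1 + Y1) / (1 + Y0)) = x0 * z / braid x0 x1 y0 y1.
Proof. by rewrite -braid_first invrK; move: (_ / _) => t; field. Qed.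

(** [Z0] and [Z1] are the values of [ra (rb x0)] and [ra (rb x1)]. *)
Let Z0 := x1^-1 * Y1 * ((1 + Y0) / (1 + Y1)).
Let Z1 := x0^-1 * Y0 * ((1 + Y1) / (1 + Y0)).

Let Z0E : Z0 = y1 * (1 + x0 + x0 * y0 * (1 + x1)) / (1 + x1 + x1 * y1 * (1 + x0)).
Proof. by rewrite /Z0 Y0a Y1a /Y1; field; rewrite n1 x0a x1a x1n. Qed.
Let Z1E : Z1 = y0 * (1 + x1 + x1 * y1 * (1 + x0)) / (1 + x0 + x0 * y0 * (1 + x1)).
Proof. by rewrite /Z1 Y0a Y1a /Y0; field; rewrite n0 x0a x1a x0n. Qed.
Let Z0a : 1 + Z0 =
  (1 + x1) * (1 + y1 + y1 * x0 * (1 + y0)) / (1 + x1 + x1 * y1 * (1 + x0)).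
Proof. by rewrite Z0E; field. Qed.
Let Z1a : 1 + Z1 =
  (1 + x0) * (1 + y0 + y0 * x1 * (1 + y1)) / (1 + x0 + x0 * y0 * (1 + x1)).
Proof. by rewrite Z1E; field. Qed.

Lemma braid_second :
  Z0 * Y1^-1 * ((1 + Z1) / (1 + Z0)) = braid y0 y1 x1 x0.
Proof.
rewrite Z0a Z1a Z0E /Y1 /braid; field.
by rewrite n0 n1 x0a x1a x1n y1n E0n.
Qed.

Lemma braid_left w :
  w * x1 * ((1 + x0) / (1 + x1)) * Z1 * ((1 + Z0) / (1 + Z1)) =
  y0 * w / braid y0 y1 x1 x0.
Proof.
have E1n' : y0 * x1 * (1 + y1) + (1 + y0) != 0 by rewrite addrC.
rewrite Z0a Z1a Z1E /braid invfM invrK; field.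
by rewrite E0n x1n E1n' x0a n1 n0 x1a.
Qed.

Variables (ra rb : {rmorphism F -> F}).
Hypotheses (rax0 : ra x0 = x1^-1) (rax1 : ra x1 = x0^-1) (ray0 : ra y0 = Y0) (ray1 : ra y1 = Y1).
Hypotheses (rbx0 : rb x0 = x0 * y1 * ((1 + y0) / (1 + y1)))
  (rbx1 : rb x1 = x1 * y0 * ((1 + y1) / (1 + y0)))
  (rby0 : rb y0 = y1^-1) (rby1 : rb y1 = y0^-1).

Let morphE := (rax0, rax1, ray0, ray1, fmorphV, rmorphM, rmorphD, rmorph1).

Lemma braid_word_first : ra (rb (ra x0)) = braid x0 x1 y0 y1.
Proof. by rewrite rax0 fmorphV rbx1 !morphE -braid_first. Qed.

Lemma braid_word_second : ra (rb (ra y0)) = braid y0 y1 x1 x0.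
Proof.
by rewrite ray0 /Y0 !(rmorphM, fmorphV, rmorphD, rmorph1) rbx0 rbx1 rby0 !morphE -braid_second.
Qed.

Lemma braid_word_left w :
  ra w = w * x1 * ((1 + x0) / (1 + x1)) -> rb w = w ->
  ra (rb (ra w)) = y0 * w / braid y0 y1 x1 x0.
Proof.
move=> raw rbw; rewrite raw !(rmorphM, fmorphV, rmorphD, rmorph1) rbx0 rbx1 rbw.
by rewrite !morphE raw -braid_left.
Qed.

Lemma braid_word_right z :
  ra z = z -> rb z = y0 * z * ((1 + y1) / (1 + y0)) ->
  ra (rb (ra z)) = x0 * z / braid x0 x1 y0 y1.
Proof. by move=> raz rbz; rewrite raz rbz !morphE raz -braid_right. Qed.

End Places.

(** * The variables, their indices and condition (C) *)

Section Phi.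
Variables (R : realType) (n : nat).
Local Notation phi := (phi R n).
Local Notation K := (K R n).
Local Notation Pr := (Pr R n).

Lemma eqmP (a b : int) :
  reflect (exists q : int, a = b + q * (2 * n + 2)%N%:Z) (eqm n a b).
Proof.
apply: (iffP idP) => [/eqP h | [q ->]]; last by rewrite /eqm addrC addKr modzMl.
exists (divz (a - b) (Mn n)); rewrite -[LHS](subrK b) addrC; congr (_ + _).
by rewrite {1}(divz_eq (a - b) (Mn n)) h addr0.
Qed.

(** For [n >= 1] the period 2n+2 is at least 4. *)
Lemma eqm_near (a b : int) : (1 <= n)%N -> eqm n a b -> `|a - b| < 4 -> a = b.
Proof.
move=> n1 /eqmP[q ->] h; have [-> | q0] := eqVneq q 0; first by rewrite mul0r addr0.
nia.
Qed.

Lemma eqm_parity (a b : int) : eqm n a b -> modz a 2 = modz b 2.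
Proof.
move=> /eqmP[q ->]; have -> : (2 * n + 2)%N%:Z = (n%:Z + 1) * 2 by lia.
by rewrite mulrA addrC modzMDl.
Qed.

Lemma phi_eqm (j k i : int) : eqm n j k -> phi j i = phi k i.
Proof.
move=> h; rewrite /Defs.phi /idx; do 5 congr (_ _).
by case/eqmP: h => q ->; rewrite addrC /Mn modzMDl.
Qed.

Lemma phi_even (j i k : int) : modz i 2 = modz k 2 -> phi j i = phi j k.
Proof. by rewrite /Defs.phi /idx => ->. Qed.

Lemma phi_period (j i : int) : phi (j + (2 * n + 2)%N%:Z) i = phi j i.
Proof. by apply/phi_eqm/eqmP; exists 1; rewrite mul1r. Qed.

Lemma phi_addr2 (j i : int) : phi j (i + 1 + 1) = phi j i.
Proof. by apply: phi_even; rewrite -addrA modzDr. Qed.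

Lemma phi_neq0 (j i : int) : phi j i != 0.
Proof.
rewrite tofrac_eq0; apply/eqP => /(congr1 (meval (fun=> 1))).
by rewrite mevalXU meval0; apply/eqP/oner_neq0.
Qed.

Lemma idx_val (j i : int) :
  idx n j i = absz (modz j (Mn n)) * 2 + absz (modz i 2) :> nat.
Proof.
rewrite inordK // /Nv /Mn.
have : 0 <= modz j (2 * n + 2)%N%:Z < (2 * n + 2)%N%:Z by rewrite modz_ge0 ?ltz_pmod //; lia.
have : 0 <= modz i 2 < 2 by rewrite modz_ge0 ?ltz_pmod.
lia.
Qed.

(** Parity form of the test in [eps_var]; it is compatible with the indices because the period 2n+2
    is even. *)
Definition special (j i : int) : bool := (modz j 2 == 1) && (modz i 2 == 1).

Definition phi_eps (j i : int) : K := if special j i then -1 else phi j i.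

Lemma eps_var_idx (j i : int) :
  eps_var R (idx n j i) = if special j i then -1 else 'X_(idx n j i).
Proof.
have jb : 0 <= modz j (Mn n) < (2 * n + 2)%N%:Z by rewrite /Mn modz_ge0 ?ltz_pmod //; lia.
have ib : 0 <= modz i 2 < 2 by rewrite modz_ge0 ?ltz_pmod.
have jq : j = divz j (Mn n) * (n%:Z + 1) * 2 + modz j (Mn n).
  by rewrite {1}(divz_eq j (Mn n)) /Mn; lia.
rewrite /eps_var; congr (if _ then _ else _); apply/existsP/andP.
  case=> k /eqP/(congr1 val); rewrite /= !idx_val (@modz_small (2 * k%:Z + 1)); last first.
    by rewrite /Mn; have := ltn_ord k; lia.
  have -> : modz 1 2 = 1 by [].
  move=> h; have [hj hi] : modz j (Mn n) = 2 * k%:Z + 1 /\ modz i 2 = 1 by lia.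
  split; last by rewrite hi.
  by rewrite jq hj modzMDl mulrC modzMDl.
move=> [/eqP oj /eqP oi].
have hj : modz (modz j (Mn n)) 2 = 1 by move: oj; rewrite {1}jq modzMDl.
have [k e k1] : exists2 k : nat, modz j (Mn n) = 2 * k%:Z + 1 & (k < n.+1)%N.
  have := divz_eq (modz j (Mn n)) 2; rewrite hj => e.
  by exists (absz (divz (modz j (Mn n)) 2%Z)); lia.
exists (Ordinal k1); apply/eqP/val_inj; rewrite /= !idx_val oi e /=.
by rewrite modz_small //= /Mn; lia.
Qed.

(** Composing with [tofrac] puts values and original elements in the same field, so that an
    unspecialized element can be its own value. *)
Definition eval_eps : {rmorphism Pr -> K} :=
  @tofrac Pr \o mmap (@mpolyC (Nv n) (Cf R)) (@eps_var R n).

Definition eval0 : {rmorphism Pr -> Cf R} := meval (fun=> 0).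

Local Notation spec := (gspec eval_eps).
Local Notation spec0 := (gspec eval0).

Lemma spec_toE f g : spec f g -> spec_to f g.
Proof.
move=> [p [q [q0 -> ->]]]; exists p, q; split=> //.
by apply: contraNneq q0 => q0; rewrite /= -[mmap _ _ q]/(eps_poly q) q0 tofrac0.
Qed.

Lemma spec_phi (j i : int) : spec (phi j i) (phi_eps j i).
Proof.
have -> : phi_eps j i = eval_eps 'X_(idx n j i); last exact: gspec_poly.
by rewrite /= mmapX mmap1U eps_var_idx /phi_eps; case: ifP => _ //; rewrite rmorphN1.
Qed.

Lemma spec0_phi (j i : int) : spec0 (phi j i) 0.
Proof. by have := gspec_poly eval0 'X_(idx n j i); rewrite /= mevalXU. Qed.

Lemma gspec_place (L : fieldType) (e : {rmorphism Pr -> L}) :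
  @place (K : fieldType) L (gspec e).
Proof.
split; [exact: gspec1 | | | |].
- by move=> f f' g g'; apply: gspecD.
- by move=> f f'; apply: gspecN.
- by move=> f f' g g'; apply: gspecM.
- by move=> f f'; apply: gspecV.
Qed.

Definition spec_place := gspec_place eval_eps.
Definition spec0_place := gspec_place eval0.

Lemma spec0_add1_neq0 (a : K) : spec0 a 0 -> 1 + a != 0.
Proof.
move=> a0; apply: (gspec_neq0 (e := eval0) (g := 1)); last exact: oner_neq0.
by rewrite -[X in gspec _ _ X]addr0; apply: gspecD (gspec1 _) a0.
Qed.

Lemma spec0_phiM (j i : int) (b : K) c : spec0 b c -> spec0 (phi j i * b) 0.
Proof. by move=> sb; rewrite -(mul0r c); apply: gspecM (spec0_phi _ _) sb. Qed.

Lemma add1_phi_neq0 (j i : int) : 1 + phi j i != 0.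
Proof. exact: spec0_add1_neq0 (spec0_phi _ _). Qed.

Lemma add1_phi_phi_neq0 (j i k l j' i' : int) :
  1 + phi j i + phi j i * phi k l * (1 + phi j' i') != 0.
Proof.
rewrite -addrA; apply: spec0_add1_neq0; rewrite -[X in gspec _ _ X]addr0.
apply: gspecD (spec0_phi _ _) _; rewrite -mulrA; apply: spec0_phiM.
by apply: spec0_phiM; apply: gspecD (gspec1 _) (spec0_phi _ _).
Qed.

Lemma spec_phi_generic (j i : int) : ~~ special j i -> spec (phi j i) (phi j i).
Proof. by move=> h; have := spec_phi j i; rewrite /phi_eps (negbTE h). Qed.

Lemma spec_phi_special (j i : int) : special j i -> spec (phi j i) (-1).
Proof. by move=> h; have := spec_phi j i; rewrite /phi_eps h. Qed.

Hypothesis n1 : (1 <= n)%N.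
Local Notation phi' := (phi' R n).

(** Regularity of the second image is enough: if its value is [h], multiplicativity gives the image
    of [alpha] the value [- h]. *)
Definition consistent (w : K -> K) (j : int) : Prop :=
  spec (w (phi j 1)) (-1) /\ exists h, spec (w (phi j 0)) h.

Lemma phi_11 (j : int) : phi j (1 + 1) = phi j 0.
Proof. exact: phi_even. Qed.

Lemma phi_01 (j : int) : phi j (0 + 1) = phi j 1.
Proof. by rewrite add0r. Qed.

Lemma not_eqm (j k : int) : modz j 2 != modz k 2 -> ~~ eqm n j k.
Proof. by apply: contraNN => /eqm_parity ->. Qed.

Lemma spec_generic j i : modz j 2 != 1 \/ modz i 2 != 1 -> spec (phi j i) (phi j i).
Proof. by move=> h; apply: spec_phi_generic; rewrite /special; lia. Qed.

Lemma spec_special j : modz j 2 = 1 -> spec (phi j 1) (-1).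
Proof. by move=> h; apply: spec_phi_special; rewrite /special h. Qed.

Lemma consistent_phi_id (w : K -> K) j :
  modz j 2 = 1 -> (forall i, w (phi j i) = phi j i) -> consistent w j.
Proof.
move=> oj wj; split; first by rewrite wj; apply: spec_special.
by exists (phi j 0); rewrite wj; apply: spec_generic; right.
Qed.

(** * The transformations $p_i$ and $p'_i$ *)

Section BraidWords.
Variables (a : int) (ra rb : {rmorphism K -> K}).
Hypotheses (raP : is_r a ra) (rbP : is_r (a + 1) rb).

Let ra0 : ra (phi a 0) = (phi a 1)^-1.
Proof. by have [_ /(_ 0)[_ ->]] := raP; rewrite phi_01. Qed.
Let ra1 : ra (phi a 1) = (phi a 0)^-1.
Proof. by have [_ /(_ 1)[_ ->]] := raP; rewrite phi_11. Qed.
Let ray0 : ra (phi (a + 1) 0) =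
  phi a 0 * phi (a + 1) 0 * ((1 + phi a 1) / (1 + phi a 0)).
Proof. by have [_ /(_ 0)[_ _ ->]] := raP; rewrite phi_01. Qed.
Let ray1 : ra (phi (a + 1) 1) =
  phi a 1 * phi (a + 1) 1 * ((1 + phi a 0) / (1 + phi a 1)).
Proof. by have [_ /(_ 1)[_ _ ->]] := raP; rewrite phi_11. Qed.
Let raw0 : ra (phi (a - 1) 0) =
  phi (a - 1) 0 * phi a 1 * ((1 + phi a 0) / (1 + phi a 1)).
Proof. by have [_ /(_ 0)[-> _ _]] := raP; rewrite phi_01. Qed.
Let raw1 : ra (phi (a - 1) 1) =
  phi (a - 1) 1 * phi a 0 * ((1 + phi a 1) / (1 + phi a 0)).
Proof. by have [_ /(_ 1)[-> _ _]] := raP; rewrite phi_11. Qed.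

Let rby0 : rb (phi (a + 1) 0) = (phi (a + 1) 1)^-1.
Proof. by have [_ /(_ 0)[_ ->]] := rbP; rewrite phi_01. Qed.
Let rby1 : rb (phi (a + 1) 1) = (phi (a + 1) 0)^-1.
Proof. by have [_ /(_ 1)[_ ->]] := rbP; rewrite phi_11. Qed.
Let rbz0 : rb (phi (a + 1 + 1) 0) =
  phi (a + 1) 0 * phi (a + 1 + 1) 0 * ((1 + phi (a + 1) 1) / (1 + phi (a + 1) 0)).
Proof. by have [_ /(_ 0)[_ _ ->]] := rbP; rewrite phi_01. Qed.
Let rbz1 : rb (phi (a + 1 + 1) 1) =
  phi (a + 1) 1 * phi (a + 1 + 1) 1 * ((1 + phi (a + 1) 0) / (1 + phi (a + 1) 1)).
Proof. by have [_ /(_ 1)[_ _ ->]] := rbP; rewrite phi_11. Qed.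
Let rbx0 : rb (phi a 0) =
  phi a 0 * phi (a + 1) 1 * ((1 + phi (a + 1) 0) / (1 + phi (a + 1) 1)).
Proof. by have [_ /(_ 0)[+ _ _]] := rbP; rewrite addrK phi_01. Qed.
Let rbx1 : rb (phi a 1) =
  phi a 1 * phi (a + 1) 0 * ((1 + phi (a + 1) 1) / (1 + phi (a + 1) 0)).
Proof. by have [_ /(_ 1)[+ _ _]] := rbP; rewrite addrK phi_11. Qed.

Let raz i : ra (phi (a + 1 + 1) i) = phi (a + 1 + 1) i.
Proof.
have [_ /(_ i)[_ _ _]] := raP; apply.
(* The indices [a + 2] and [a] have equal parity, so the size of the period is needed; the other two
   cases differ in parity. *)
- by apply/negP => /(eqm_near n1); lia.
- by apply: not_eqm; lia.
- by apply: not_eqm; lia.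
Qed.

Let rbw i : rb (phi (a - 1) i) = phi (a - 1) i.
Proof.
have [_ /(_ i)[_ _ _]] := rbP; apply.
- by apply/negP => /(eqm_near n1); lia.
- by apply: not_eqm; lia.
- by apply: not_eqm; lia.
Qed.

Let phin := phi_neq0.
Let add1n := add1_phi_neq0.
Let add1n2 := add1_phi_phi_neq0.

Let first0 : ra (rb (ra (phi a 0))) =
  braid (phi a 0) (phi a 1) (phi (a + 1) 0) (phi (a + 1) 1).
Proof. by apply: braid_word_first. Qed.
Let first1 : ra (rb (ra (phi a 1))) =
  braid (phi a 1) (phi a 0) (phi (a + 1) 1) (phi (a + 1) 0).
Proof. by apply: braid_word_first. Qed.
Let second0 : ra (rb (ra (phi (a + 1) 0))) =
  braid (phi (a + 1) 0) (phi (a + 1) 1) (phi a 1) (phi a 0).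
Proof. by apply: braid_word_second. Qed.
Let second1 : ra (rb (ra (phi (a + 1) 1))) =
  braid (phi (a + 1) 1) (phi (a + 1) 0) (phi a 0) (phi a 1).
Proof. by apply: braid_word_second. Qed.

Let right0 : ra (rb (ra (phi (a + 1 + 1) 0))) =
  phi a 0 * phi (a + 1 + 1) 0 / braid (phi a 0) (phi a 1) (phi (a + 1) 0) (phi (a + 1) 1).
Proof. by apply: braid_word_right. Qed.
Let right1 : ra (rb (ra (phi (a + 1 + 1) 1))) =
  phi a 1 * phi (a + 1 + 1) 1 / braid (phi a 1) (phi a 0) (phi (a + 1) 1) (phi (a + 1) 0).
Proof. by apply: braid_word_right. Qed.
Let left0 : ra (rb (ra (phi (a - 1) 0))) =
  phi (a + 1) 0 * phi (a - 1) 0 / braid (phi (a + 1) 0) (phi (a + 1) 1) (phi a 1) (phi a 0).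
Proof. by apply: braid_word_left. Qed.
Let left1 : ra (rb (ra (phi (a - 1) 1))) =
  phi (a + 1) 1 * phi (a - 1) 1 / braid (phi (a + 1) 1) (phi (a + 1) 0) (phi a 0) (phi a 1).
Proof. by apply: braid_word_left. Qed.

Let ra_far j i : ~~ eqm n j a -> ~~ eqm n j (a - 1) -> ~~ eqm n j (a + 1) ->
  ra (phi j i) = phi j i.
Proof. by have [_ /(_ i)[_ _ _]] := raP; apply. Qed.
Let rb_far j i : ~~ eqm n j a -> ~~ eqm n j (a + 1) -> ~~ eqm n j (a + 1 + 1) ->
  rb (phi j i) = phi j i.
Proof. by have [_ /(_ i)[_ _ _ h]] := rbP => ja *; apply: h; rewrite ?addrK. Qed.

(** For odd [a] the odd indices moved by the word are [a] and [a + 2]; in the even case below they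
    are [a + 1] and [a - 1]. *)
Lemma consistent_braid_odd j :
  modz a 2 = 1 -> modz j 2 = 1 -> consistent (ra \o rb \o ra) j.
Proof.
move=> oa oj.
have [b1 [h h0 b0]] : spec (braid (phi a 1) (phi a 0) (phi (a + 1) 1) (phi (a + 1) 0)) (-1)
  /\ exists2 h, h != 0 &
     spec (braid (phi a 0) (phi a 1) (phi (a + 1) 0) (phi (a + 1) 1)) h.
  apply: (place_braid spec_place) => //; first exact: spec_special.
  - by apply: spec_generic; right.
  - by apply: spec_generic; left; lia.
  - by apply: spec_generic; left; lia.
have [ja|ja] := boolP (eqm n j a).
  rewrite /consistent !(phi_eqm _ ja) /= first0 first1.
  by split=> //; exists h.
have [jz|jz] := boolP (eqm n j (a + 1 + 1)).
  rewrite /consistent !(phi_eqm _ jz) /= right0 right1; split.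
    by apply: (place_mul_divN1 spec_place) => //; apply: spec_special; lia.
  exists (phi a 0 * phi (a + 1 + 1) 0 / h).
  by apply: (place_mul_div spec_place) => //; apply: spec_generic; right.
apply: consistent_phi_id => // i /=.
by rewrite ra_far ?rb_far ?ra_far //; apply: not_eqm; lia.
Qed.

Lemma consistent_braid_even j :
  modz a 2 = 0 -> modz j 2 = 1 -> consistent (ra \o rb \o ra) j.
Proof.
move=> ea oj.
have [b1 [h h0 b0]] : spec (braid (phi (a + 1) 1) (phi (a + 1) 0) (phi a 0) (phi a 1)) (-1)
  /\ exists2 h, h != 0 &
     spec (braid (phi (a + 1) 0) (phi (a + 1) 1) (phi a 1) (phi a 0)) h.
  apply: (place_braid spec_place) => //; first by apply: spec_special; lia.
  - by apply: spec_generic; right.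
  - by apply: spec_generic; left; lia.
  - by apply: spec_generic; left; lia.
have [jb|jb] := boolP (eqm n j (a + 1)).
  rewrite /consistent !(phi_eqm _ jb) /= second0 second1.
  by split=> //; exists h.
have [jw|jw] := boolP (eqm n j (a - 1)).
  rewrite /consistent !(phi_eqm _ jw) /= left0 left1; split.
    by apply: (place_mul_divN1 spec_place) => //; apply: spec_special; lia.
  exists (phi (a + 1) 0 * phi (a - 1) 0 / h).
  by apply: (place_mul_div spec_place) => //; apply: spec_generic; right.
apply: consistent_phi_id => // i /=.
by rewrite ra_far ?rb_far ?ra_far //; apply: not_eqm; lia.
Qed.

End BraidWords.
Local Notation N := (2 * n + 2)%N.

Lemma phi_eps_period k i : phi_eps (k + N%:Z) i = phi_eps k i.
Proof.
rewrite /phi_eps phi_period; congr (if _ then _ else _).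
by rewrite /special; lia.
Qed.

Lemma spec0_phi_eps k i : spec0 (phi_eps k i) (if special k i then -1 else 0).
Proof.
rewrite /phi_eps; case: ifP => _; last exact: spec0_phi.
by apply: (placeN spec0_place); apply: gspec1.
Qed.

Lemma even_far (k m : nat) (c : int) :
  (k < n.+1)%N -> (m < n.+1)%N -> k != m -> ~~ eqm n (2 * k%:Z + c) (2 * m%:Z + c).
Proof.
move=> kn mn; apply: contraNN => /eqmP[q]; rewrite PoszD PoszM => h.
have {}h : k%:Z = m%:Z + q * (n%:Z + 1) by lia.
have q0 : q = 0.
  have [q1|[q1|//]] : 1 <= q \/ q <= -1 \/ q = 0 by lia.
  - by have := ler_wpM2r (isT : 0 <= n%:Z + 1) q1; lia.
  - by have := ler_wpM2r (isT : 0 <= n%:Z + 1) q1; lia.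
by apply/eqP; move: h; rewrite q0; lia.
Qed.

(** * The transformation $\sigma$ *)

Section Sigma.
Variables (r : int -> {rmorphism K -> K}) (s pi : {rmorphism K -> K}).
Hypotheses (rP : forall j, is_r j (r j)) (sP : is_s 0 s) (piP : is_pi pi).

Lemma r_odd_phi (m : 'I_n.+1) i :
  r_odd (fun j => r j : K -> K) (phi (2 * (m : nat)%:Z + 1) i) =
  (phi (2 * (m : nat)%:Z + 1) (i + 1))^-1.
Proof.
have rm : r (2 * (m : nat)%:Z + 1) (phi (2 * (m : nat)%:Z + 1) i) =
    (phi (2 * (m : nat)%:Z + 1) (i + 1))^-1.
  by have [_ /(_ i)[_ ->]] := rP (2 * (m : nat)%:Z + 1).
rewrite /r_odd (@fold_one _ (fun k => r (2 * k%:Z + 1)) _ m _ _ (iota_uniq _ _) rm).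
- by rewrite mem_iota ltn_ord.
- move=> k; rewrite mem_iota => kn km; have [_ /(_ i)[_ _ _]] := rP (2 * k%:Z + 1); apply.
  + by apply: even_far; rewrite ?ltn_ord // eq_sym.
  + by apply: not_eqm; lia.
  + by apply: not_eqm; lia.
- move=> k; rewrite mem_iota => kn km; rewrite fmorphV.
  have [_ /(_ (i + 1))[_ _ _ ->]] // := rP (2 * k%:Z + 1).
  + by apply: even_far; rewrite ?ltn_ord // eq_sym.
  + by apply: not_eqm; lia.
  + by apply: not_eqm; lia.
Qed.

Lemma spec_Q1 j : spec (csum (phi^~ 1) N j) (csum (phi_eps^~ 1) N j).
Proof. by apply: (place_csum spec_place) => k; apply: spec_phi. Qed.

Lemma consistent_sigma (m : 'I_n.+1) :
  consistent (sigma_ pi (fun=> s) (fun j => r j : K -> K)) (2 * (m : nat)%:Z + 1).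
Proof.
rewrite /consistent /sigma_ /= !r_odd_phi.
set j := 2 * _ + 1; have oj : modz j 2 = 1 by rewrite /j; lia.
rewrite phi_11 phi_01.
have pi_phi k i : pi (phi k i) = phi (k + 1) (i + 1) by have [_ ->] := piP.
have pi_Q k : pi (Q R n k 0) = csum (phi^~ 1) N (k + 1).
  apply: (@rmorph_csum _ pi (phi^~ 0) (phi^~ 1) N k 1) => l.
  by rewrite pi_phi phi_01.
have s0 : s (phi j 0) = (phi (j + 1) 0)^-1 * (Q R n j 0 / Q R n (j + 2) 0).
  by have [_ /(_ j)[]] := sP.
have s1 : s (phi j 1) = phi j 0 * phi j 1 * phi (j + 1) 0 * (Q R n (j + 2) 0 / Q R n j 0).
  by have [_ /(_ j)[_]] := sP; rewrite !phi_01.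
have ej : ~~ special (j + 1) 1 by rewrite /special; lia.
set q := csum (phi_eps^~ 1) N (j + 1).
(* The sum starts at the even index [j + 1], so the factors at odd offsets are exactly those equal
   to -1. *)
have qE : csum (phi_eps^~ 1) N (j + 2 + 1) = q.
  have -> : j + 2 + 1 = j + 1 + 2 by ring.
  apply: csum_alternating_shift => [l|k|]; last by rewrite /phi_eps (negbTE ej) phi_neq0.
    by rewrite /phi_eps ifT // /special; lia.
  exact: phi_eps_period.
have q0 : q != 0.
  rewrite /q csum_alternating; last first.
    by move=> l; rewrite /phi_eps ifT // /special; lia.
  rewrite addn1; apply: spec0_add1_neq0.
  (* At the origin some factors are -1, but the first one, of even index, is 0. *)
  have <- : cprod (fun k => if special k 1 then -1 else 0) (2 * n).+1 (j + 1) = 0 :> Cf R.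
    by rewrite cprodS (negbTE ej) mul0r.
  by apply: (place_cprod spec0_place) => k; apply: spec0_phi_eps.

have sq : spec (csum (phi^~ 1) N (j + 1)) q by apply: spec_Q1.
have sq' : spec (csum (phi^~ 1) N (j + 2 + 1)) q by rewrite -qE; apply: spec_Q1.
rewrite !fmorphV s0 s1 rmorph_ratio rmorph_ratio2 !pi_Q !pi_phi !phi_11 !phi_01.
split.
  by apply: (place_ratio spec_place q0 _ sq sq'); apply: spec_special; lia.
apply: (place_ratio2 spec_place q0 _ _ _ _ _ sq sq').
- exact: phi_neq0.
- exact: phi_neq0.
- by apply: spec_generic; left; lia.
- by apply: spec_generic; left; lia.
- by apply: spec_special; lia.
Qed.

End Sigma.

(** * The transformation $\sigma'$ *)

Section SigmaPrime.
Variables (r : int -> {rmorphism K -> K}) (s pi' p : {rmorphism K -> K}).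
Hypotheses (rP : forall j, is_r j (r j)) (sP : is_s' 0 s) (piP : is_pi' pi').
Hypothesis pK : cancel pi' p.

Lemma r_even_phi (m : 'I_n.+1) i (j := 2 * (m : nat)%:Z + 1) :
  r_even (fun j => r j : K -> K) (phi j i) =
  phi j i * (phi (j - 1) i * ((1 + phi (j - 1) (i + 1)) / (1 + phi (j - 1) i)))
          * (phi (j + 1) (i + 1) * ((1 + phi (j + 1) i) / (1 + phi (j + 1) (i + 1)))).
Proof.
(* The letter of index [j + 1] is the one numbered [b]; it wraps around to 0 when [m = n]. Since
   [n >= 1], it differs from the letter [j - 1], numbered [m]. *)
pose b : nat := (m.+1 %% n.+1)%N.
have bn : (b < n.+1)%N by rewrite ltn_mod.
have bE : eqm n (2 * b%:Z) (j + 1).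
  apply/eqmP; exists (- (m.+1 %/ n.+1)%N%:Z); rewrite /j.
  have := divn_eq m.+1 n.+1; rewrite -/b => h.
  have : (m.+1%:Z = (m.+1 %/ n.+1)%N%:Z * (n%:Z + 1) + b%:Z) by rewrite {1}h; lia.
  by lia.
have mb : m != b :> nat.
  rewrite /b; have [mn|mn] := ltnP m n; first by rewrite modn_small //; lia.
  have -> : m = n :> nat by have := ltn_ord m; lia.
  by rewrite modnn; lia.
have rm : r (2 * (m : nat)%:Z) (phi j i) =
    phi j i * (phi (j - 1) i * ((1 + phi (j - 1) (i + 1)) / (1 + phi (j - 1) i))).
  have [_ /(_ i)[_ _ + _]] := rP (2 * (m : nat)%:Z); rewrite -/j => ->.
  have -> : 2 * (m : nat)%:Z = j - 1 by rewrite /j addrK.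
  by rewrite !mulrA [phi _ _ * phi _ _]mulrC.
have bphi k : phi (2 * b%:Z) k = phi (j + 1) k by apply: phi_eqm.
have rb : r (2 * b%:Z) (phi j i) =
    phi j i * (phi (j + 1) (i + 1) * ((1 + phi (j + 1) i) / (1 + phi (j + 1) (i + 1)))).
  have jb : eqm n j (2 * b%:Z - 1).
    by move: bE => /eqmP[q e]; apply/eqmP; exists (- q); rewrite e; ring.
  have [_ /(_ i)[+ _ _ _]] := rP (2 * b%:Z).
  by rewrite -(phi_eqm _ jb) !bphi => ->; rewrite [RHS]mulrA.
have fix_even k c l : (k < n.+1)%N -> (c < n.+1)%N -> k != c ->
    r (2 * k%:Z) (phi (2 * c%:Z) l) = phi (2 * c%:Z) l.
  move=> kn cn kc; have [_ /(_ l)[_ _ _]] := rP (2 * k%:Z); apply.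
  - by have := even_far 0 cn kn; rewrite !addr0; apply; rewrite eq_sym.
  - by apply: not_eqm; lia.
  - by apply: not_eqm; lia.
have jm : j - 1 = 2 * (m : nat)%:Z by rewrite /j addrK.
rewrite /r_even (@fold_two _ (fun k => r (2 * k%:Z)) _ m b _ _ _ (iota_uniq _ _) mb rm rb).
- by rewrite !mem_iota ltn_ord bn.
- move=> k; rewrite mem_iota => kn km kb; have [_ /(_ i)[_ _ _]] := rP (2 * k%:Z); apply.
  + by apply: not_eqm; lia.
  + apply/negP => /eqmP[q e]; move: bE => /eqmP[q' e'].
    have := even_far 0 kn bn kb; rewrite !addr0 => /negP; apply; apply/eqmP.
    by exists (- q - q'); rewrite e' e; ring.
  + by apply: even_far; rewrite ?ltn_ord // eq_sym.
- move=> k; rewrite mem_iota => kn km.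
  by apply: rmorph_fix; rewrite jm; apply: fix_even.
- move=> k; rewrite mem_iota => kn kb.
  by apply: rmorph_fix; rewrite -!bphi; apply: fix_even.
Qed.

Lemma phi_phi' k i : phi k i = phi' (- k) (i - k).
Proof. by rewrite /Defs.phi' opprK subrK. Qed.

Lemma phi'_even k i l : modz i 2 = modz l 2 -> phi' k i = phi' k l.
Proof. by move=> h; apply: phi_even; lia. Qed.

(** Unprimed, this is $\varphi_{-k,1-k}$, whose two indices are never both odd; hence [eps] fixes
    every [G k]. *)
Let G k := phi' k 1.
Let QG := csum G N.

Lemma phi'_period k : G (k + N%:Z) = G k.
Proof.
rewrite /G /Defs.phi' -[RHS]phi_period (_ : - k = - (k + N%:Z) + N%:Z); last by ring.
by rewrite phi_period phi_period; apply: phi_even; lia.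
Qed.

(** [p] lowers the first unprimed index by 1, which in primed indices raises both. *)
Lemma p_phi' k i : p (phi' k i) = phi' (k + 1) (i + 1).
Proof.
have -> : phi' k i = pi' (phi (- k - 1) (i - k)) by have [_ ->] := piP; rewrite subrK.
rewrite pK (_ : - k - 1 = - (k + 1)); last by ring.
by rewrite (_ : i - k = i + 1 - (k + 1)); last by ring.
Qed.

(** The shifted indices are variables so that callers can supply them in the form they use. *)
Lemma p_s_phi'0 k k1 k2 k3 : k1 = k + 1 -> k2 = k + 2 -> k3 = k + 3 ->
  p (s (phi' k 0)) = (G k2)^-1 * (QG k1 / QG k3).
Proof.
move=> -> -> ->; have [_ /(_ k)[-> _]] := sP.
have pQ l : p (Q' R n l 0) = QG (l + 1).
  apply: (@rmorph_csum _ p (phi'^~ 0) G N l 1) => h.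
  by rewrite p_phi' add0r.
by rewrite rmorph_ratio p_phi' !pQ add0r /G -!addrA.
Qed.

Lemma p_s_phi'1 k k1 k2 k3 : k1 = k + 1 -> k2 = k + 2 -> k3 = k + 3 ->
  p (s (phi' k 1)) = G k1 * phi' k1 0 * G k2 * (QG k3 / QG k1).
Proof.
move=> -> -> ->; have [_ /(_ k)[_]] := sP; rewrite add0r => ->.
have pQ l : p (Q' R n l 0) = QG (l + 1).
  apply: (@rmorph_csum _ p (phi'^~ 0) G N l 1) => h.
  by rewrite p_phi' add0r.
rewrite rmorph_ratio2 !p_phi' !pQ add0r /G -!addrA.
by rewrite (@phi'_even _ (1 + 1) 0).
Qed.

Lemma spec_G k : spec (G k) (G k).
Proof. by apply: spec_generic; lia. Qed.

Lemma spec_QG k : spec (QG k) (QG k).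
Proof. by apply: (place_csum spec_place) => l; apply: spec_G. Qed.

Lemma QG_neq0 k : QG k != 0.
Proof.
apply: (gspec_neq0 (e := eval0) (g := 1)); last exact: oner_neq0.
rewrite -(@csum0 _ (2 * n).+1 k) /QG addn2.
by apply: (place_csum spec0_place) => l; apply: spec0_phi.
Qed.

(** The product over a full period does not depend on its start, so one constant serves for all
    [k]. *)
Lemma QG_step k k1 : k1 = k + 1 -> QG k = G k * QG k1 + (1 - cprod G N 0).
Proof.
have cG l : cprod G N (l + 1) = cprod G N l.
  by apply: cprod_shift => [h|]; [apply: phi'_period | apply: phi_neq0].
move=> ->; rewrite /QG csumS; congr (_ + (1 - _)).
elim/int_rect: k => // m IH; rewrite -{}IH.
  by rewrite (_ : m.+1%:Z = m%:Z + 1) ?cG //; lia.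
by rewrite (_ : - m%:Z = - m.+1%:Z + 1) ?cG //; lia.
Qed.

Lemma consistent_sigma' (m : 'I_n.+1) :
  consistent (sigma'_ p (fun=> s) (fun j => r j : K -> K)) (2 * (m : nat)%:Z + 1).
Proof.
rewrite /consistent /sigma'_ /= !r_even_phi !phi_11 !phi_01.
set j := 2 * _ + 1; have oj : modz j 2 = 1 by rewrite /j; lia.
set J := - j.
(* Passing to primed variables negates the first index and flips the second one exactly when the
   first is odd. *)
have phiE k l i : modz (i - k) 2 = modz l 2 -> phi k i = phi' (- k) l.
  by move=> h; rewrite phi_phi'; apply: phi'_even.
have f0 : phi j 1 = phi' J 0 by apply: phiE; lia.
have g0 : phi j 0 = phi' J 1 by apply: phiE; lia.
have fp : phi (j - 1) 0 = phi' (J + 1) 0.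
  by rewrite (_ : J + 1 = - (j - 1)); [apply: phiE; lia | rewrite /J; ring].
have gp : phi (j - 1) 1 = phi' (J + 1) 1.
  by rewrite (_ : J + 1 = - (j - 1)); [apply: phiE; lia | rewrite /J; ring].
have fm : phi (j + 1) 0 = phi' (J - 1) 0.
  by rewrite (_ : J - 1 = - (j + 1)); [apply: phiE; lia | rewrite /J; ring].
have gm : phi (j + 1) 1 = phi' (J - 1) 1.
  by rewrite (_ : J - 1 = - (j + 1)); [apply: phiE; lia | rewrite /J; ring].
rewrite f0 g0 fp gp fm gm !rmorph_shift.
have A0 := @p_s_phi'0 J (J + 1) (J + 2) (J + 3) erefl erefl erefl.
have B0 := @p_s_phi'1 J (J + 1) (J + 2) (J + 3) erefl erefl erefl.
have Ap : p (s (phi' (J + 1) 0)) = (G (J + 3))^-1 * (QG (J + 2) / QG (J + 4)).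
  by apply: p_s_phi'0; ring.
have Bp : p (s (phi' (J + 1) 1)) =
    G (J + 2) * phi' (J + 2) 0 * G (J + 3) * (QG (J + 4) / QG (J + 2)).
  by apply: p_s_phi'1; ring.
have Am : p (s (phi' (J - 1) 0)) = (G (J + 1))^-1 * (QG J / QG (J + 2)).
  by apply: p_s_phi'0; ring.
have Bm : p (s (phi' (J - 1) 1)) =
    G J * phi' J 0 * G (J + 1) * (QG (J + 2) / QG J).
  by apply: p_s_phi'1; ring.
rewrite {}A0 {}B0 {}Ap {}Bp {}Am {}Bm.
have Gn k : G k != 0 by apply: phi_neq0.
have b0 : 1 - cprod G N 0 != 0.
  apply: spec0_add1_neq0; rewrite -[X in gspec _ _ X]oppr0.
  apply: (placeN spec0_place); rewrite -(@cprod0 _ (2 * n).+1 0) addn2.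
  by apply: (place_cprod spec0_place) => l; apply: spec0_phi.
have sf k : modz k 2 = 1 -> spec (phi' k 0) (-1).
  by move=> ok; apply: spec_phi_special; rewrite /special; lia.
apply: (place_shifts spec_place (b := 1 - cprod G N 0)).
- exact: QG_step.
- by apply: QG_step; ring.
- by apply: QG_step; ring.
- by apply: QG_step; ring.
- exact: Gn.
- exact: Gn.
- exact: Gn.
- exact: Gn.
- exact: QG_neq0.
- exact: QG_neq0.
- exact: QG_neq0.
- exact: QG_neq0.
- exact: QG_neq0.
- exact: b0.
- exact: add1_phi_neq0.
- exact: add1_phi_neq0.
- exact: spec_G.
- exact: spec_G.
- exact: spec_G.
- exact: spec_G.
- exact: spec_QG.
- exact: spec_QG.
- exact: spec_QG.
- exact: spec_QG.
- exact: spec_QG.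
- by apply: sf; lia.
- by apply: spec_generic; lia.
- by apply: sf; lia.
Qed.

End SigmaPrime.

(** * The transformations $\pi_1$ and $\pi_2$ *)

Section Permutations.
Variables (pi pi' p rho : {rmorphism K -> K}).
Hypotheses (piP : is_pi pi) (pi'P : is_pi' pi') (rhoP : is_rho rho).
Hypothesis pK : cancel pi' p.

Lemma consistent_pi1 j : modz j 2 = 1 -> consistent (pi1_ pi) j.
Proof.
move=> oj; have piE k i : pi (phi k i) = phi (k + 1) (i + 1) by have [_ ->] := piP.
rewrite /consistent /pi1_ /= !piE !phi_addr2; split; first by apply: spec_special; lia.
by exists (phi (j + 1 + 1) 0); apply: spec_generic; lia.
Qed.

Lemma consistent_pi2 j : modz j 2 = 1 -> consistent (pi2_ rho p pi) j.
Proof.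
move=> oj.
(* For odd [j] the new second index has the parity of [i], and [- j] is odd. *)
have wE i : pi2_ rho p pi (phi j i) = phi (- j) (i + 1 - j).
  have [_ piE] := piP; have [_ pi'E] := pi'P; have [_ rhoE] := rhoP.
  by rewrite /pi2_ /= piE -pi'E pK rhoE.
rewrite /consistent !wE; split; first by apply: spec_phi_special; rewrite /special; lia.
by exists (phi (- j) (0 + 1 - j)); apply: spec_generic; lia.
Qed.

End Permutations.

(** * From consistency to the stated specializations *)

Lemma consistent_spec_to (w : K -> K) j :
  {morph w : x y / x * y} -> consistent w j ->
  spec_to (w (phi j 1)) (-1) /\
  exists g : K, spec_to (w (phi j 0)) (- g) /\ spec_to (w (alpha R n j)) g.
Proof.
move=> wM [w1 [h w0]]; split; first exact: spec_toE.
exists (- h); split; first by rewrite opprK; apply: spec_toE.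
rewrite /alpha wM; apply: spec_toE; rewrite -mulrN1.
exact: (placeM spec_place w0 w1).
Qed.

End Phi.

Theorem theorem3p1 (R : realType) (n : nat) (hn : (1 <= n)%N)
  (r s s' : int -> {rmorphism K R n -> K R n})
  (pi pi' pi'inv rho : {rmorphism K R n -> K R n}) :
  (forall j : int, is_r j (r j)) ->
  (forall i : int, is_s i (s i)) ->
  (forall i : int, is_s' i (s' i)) ->
  is_pi pi -> is_pi' pi' ->
  cancel pi' pi'inv -> cancel pi'inv pi' ->
  is_rho rho ->
  forall w : K R n -> K R n,
    is_omega (fun j => r j : K R n -> K R n) (fun i => s i : K R n -> K R n)
      (fun i => s' i : K R n -> K R n) pi pi'inv rho w ->
  forall j : 'I_n.+1,
    spec_to (w (phi R n (2 * (j : nat)%:Z + 1) 1)) (-1) /\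
    exists g : K R n,
      spec_to (w (phi R n (2 * (j : nat)%:Z + 1) 0)) (- g) /\
      spec_to (w (alpha R n (2 * (j : nat)%:Z + 1))) g.
Proof.
move=> rP sP s'P piP pi'P pi'K _ rhoP w wP j.
have oj : modz (2 * (j : nat)%:Z + 1) 2 = 1 by lia.
case: wP => [[i ->]|[[i ->]|[->|[->|[->|->]]]]]; apply: consistent_spec_to => //.
- by move=> x y; rewrite /p_ /= !rmorphM.
(* The outer letter has odd index -2i-3 here and even index -2i-4 for [p'_]. *)
- apply: (@consistent_braid_odd _ _ hn _ _ _ (rP _)) => //; last by lia.
  by have := rP (-2 * (i : nat)%:Z - 2); congr is_r; ring.
- by move=> x y; rewrite /p'_ /= !rmorphM.
- apply: (@consistent_braid_even _ _ hn _ _ _ (rP _)) => //; last by lia.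
  by have := rP (-2 * (i : nat)%:Z - 3); congr is_r; ring.
- move=> x y; rewrite /sigma_ /= /r_odd.
  by rewrite (@fold_morphM _ (fun k => r (2 * k%:Z + 1))) !rmorphM.
- exact: (consistent_sigma hn rP (sP 0) piP).
- move=> x y; rewrite /sigma'_ /= /r_even.
  by rewrite (@fold_morphM _ (fun k => r (2 * k%:Z))) !rmorphM.
- exact: (consistent_sigma' hn rP (s'P 0) pi'P pi'K).
- by move=> x y; rewrite /pi1_ /= !rmorphM.
- exact: consistent_pi1.
- by move=> x y; rewrite /pi2_ /= !rmorphM.
- exact: (consistent_pi2 hn piP pi'P rhoP pi'K).
Qed.
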